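(* Let $\phi\ne1$ and consider the PDE $$-\frac{h_t}{(1-\phi)h}+r-\beta^\phi h^{-1}+\frac{1}{2\gamma}\eta^2(\nu)+\frac{\beta\phi}{\phi-1}\left(\beta^{\phi-1}h^{-1}-1\right)-\frac{1}{1-\phi}\left[m_1(\nu)+\frac{\eta(\nu)}{\gamma}\rho m_2(\nu)(1-\gamma)\right]\frac{h_\nu}{h}+\frac{1}{2(1-\phi)^2}m_2^2(\nu)\left[2-\phi-\gamma+\frac{\rho^2(1-\gamma)^2}{\gamma}\right]\frac{h_\nu^2}{h^2}-\frac{1}{2(1-\phi)}m_2^2(\nu)\frac{h_{\nu\nu}}{h}=0.$$ Assume that $h$ is conjectured in the form $h(t,\nu)=\exp\left\{A_0(T-t)+\sum_{k=1}^n\frac1kA_k(T-t)\nu^k\right\}$, i.e. $\omega(t,x,\nu)=\frac{x^{1-\gamma}}{1-\gamma}\exp\left\{-\frac{1-\gamma}{1-\phi}\left(A_0(T-t)+\sum_{k=1}^n\frac1kA_k(T-t)\nu^k\right)\right\}$, where $A_k(\tau)$, $k=0,\dots,n$, are functions of $\tau$ with $A_0(0)=(\phi-1)\ln\varepsilon$ and $A_k(0)=0$ for $k=1,\dots,n$. (i) If $\eta(\nu)$ is a constant, then the PDE has an approximate solution (of this form) under the log-linear approximation method when $n=0$. (ii) If $\eta^2(\nu)$, $m_1(\nu)$, $\eta(\nu)m_2(\nu)$ and $m_2^2(\nu)$ are linear in $\nu$, then the PDE has an approximate solution (of this form) under the log-linear approximation method when $n=1$. (iii) If $\eta^2(\nu)$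 is quadratic in $\nu$, $m_1(\nu)$ and $\eta(\nu)m_2(\nu)$ are linear in $\nu$, and $m_2^2(\nu)$ is a constant, then the PDE has an approximate solution (of this form) under the log-linear approximation method when $n=2$.
   Context: Parameters: $T>0$, $r>0$, $\beta>0$, $\varepsilon>0$, $\gamma>0$ with $\gamma\neq1$, $\phi>0$ with $\phi\ne1$ (elasticity of intertemporal substitution), $\rho\in[-1,1]$; $\eta,m_1,m_2$ are real functions of the state variable $\nu$, where $d\nu_t=m_1(\nu_t)dt+m_2(\nu_t)dW^\nu_t$ and $\eta(\nu_t)$ is the market price of risk. ''Linear in $\nu$'' means a first-order polynomial $a+b\nu$. Equations are to hold for $t\in[0,T]$ and identically in $\nu$ on the state space. The PDE arises from the finite-horizon consumption–investment problem with Epstein–Zin recursive utility, $\phi\neq1$, and bequest utility $U(x)=\varepsilon^{1-\gamma}\frac{x^{1-\gamma}}{1-\gamma}$, via the ansatz $\omega(t,x,\nu)=\frac{x^{1-\gamma}}{1-\gamma}h(t,\nu)^{-\frac{1-\gamma}{1-\phi}}$; the corresponding optimal consumption is $c^*_t=\beta^\phi h^{-1}x$, where $x$ is wealth. Log-linear approximation method (finite horizon): let $\widetilde v$ be the long-run mean of the state variable. The term $\beta^\phi h^{-1}=c^*_t/x$ is replaced everywhere by its first-order expansion around $(\ln c^*_t-\ln x)|_{\nu_t=\widetilde v}$, $$\beta^\phi h^{-1}\approx\zeta_3+\zeta_4(\ln c^*_t-\ln x)=\zeta_3+\zeta_4(\phi\ln\beta-\ln h),$$ where $\zeta_3=\exp\{(\ln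 c^*_t-\ln x)|_{\nu_t=\widetilde v}\}\left[1-(\ln c^*_t-\ln x)|_{\nu_t=\widetilde v}\right]$ and $\zeta_4=\exp\{(\ln c^*_t-\ln x)|_{\nu_t=\widetilde v}\}$ depend on time but not on $\nu$. An approximate solution of the PDE under the log-linear approximation method is a function $h$ (here of the stated exponential-polynomial form) satisfying the PDE after this replacement, with $\beta^{\phi-1}h^{-1}=\beta^{-1}\cdot\beta^\phi h^{-1}$ replaced accordingly. For $n=0$ the sum is empty.
   Formalization: In (ii) and (iii) existence on all of [0,T] can fail since the A_k may blow up; the formal claim is that either an approximate solution exists on [0,T], or for some τ≤T the same A_k give one on every horizon shorter than τ and Σ|A_k| tends to infinity at τ. *)

(* Defs.v *)
From Stdlib Require Import Reals.
From Coquelicot Require Import Coquelicot.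
Open Scope R_scope.

(* [state] is the state space of the state variable nu and [vbar] its long-run
   mean; sign conditions on the constants are hypotheses of the theorem. *)
Record model := Model {
  r : R;
  beta : R;
  gamma : R;
  phi : R;
  rho : R;
  eps : R;
  vbar : R;
  state : R -> Prop;
  eta : R -> R;
  m1 : R -> R;
  m2 : R -> R
}.

Definition constant_on (D : R -> Prop) (f : R -> R) : Prop :=
  exists a, forall v, D v -> f v = a.

(* Polynomials of degree at most one, respectively two. *)
Definition linear_on (D : R -> Prop) (f : R -> R) : Prop :=
  exists a b, forall v, D v -> f v = a + b * v.

Definition quadratic_on (D : R -> Prop) (f : R -> R) : Prop :=
  exists a b c, forall v, D v -> f v = a + b * v + c * v ^ 2.

(* Left-hand side of the PDE, with the consumption-wealth ratio
   beta^phi h^{-1} abstracted as [q]; beta^{phi-1} h^{-1} is then q / beta.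
   The exact PDE is the case q = beta^phi / h. *)
Definition pde_lhs (p : model) (q h : R -> R -> R) (t v : R) : R :=
  let h_t := Derive (fun s => h s v) t in
  let h_v := Derive (fun y => h t y) v in
  let h_vv := Derive_n (fun y => h t y) 2 v in
  - (h_t / ((1 - phi p) * h t v))
  + r p - q t v
  + 1 / (2 * gamma p) * eta p v ^ 2
  + beta p * phi p / (phi p - 1) * (q t v / beta p - 1)
  - 1 / (1 - phi p)
    * (m1 p v + eta p v / gamma p * rho p * m2 p v * (1 - gamma p))
    * (h_v / h t v)
  + 1 / (2 * (1 - phi p) ^ 2) * m2 p v ^ 2
    * (2 - phi p - gamma p + rho p ^ 2 * (1 - gamma p) ^ 2 / gamma p)
    * (h_v ^ 2 / h t v ^ 2)
  - 1 / (2 * (1 - phi p)) * m2 p v ^ 2 * (h_vv / h t v).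

(* ln c* - ln x, where c* = beta^phi h^{-1} x. *)
Definition log_cw (p : model) (h : R -> R -> R) (t v : R) : R :=
  phi p * ln (beta p) - ln (h t v).

Definition zeta3 (p : model) (h : R -> R -> R) (t : R) : R :=
  exp (log_cw p h t (vbar p)) * (1 - log_cw p h t (vbar p)).

Definition zeta4 (p : model) (h : R -> R -> R) (t : R) : R :=
  exp (log_cw p h t (vbar p)).

Definition loglin_cw (p : model) (h : R -> R -> R) (t v : R) : R :=
  zeta3 p h t + zeta4 p h t * log_cw p h t v.

(* Classical solution on [0, T] of the PDE after the log-linear replacement;
   the differentiability clauses are needed because [Derive] is total. *)
Definition approx_solution (p : model) (T : R) (h : R -> R -> R) : Prop :=
  forall t v, 0 <= t <= T -> state p v ->
    0 < h t v /\
    ex_derive (fun s => h s v) t /\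
    locally v (fun y => ex_derive (fun z => h t z) y) /\
    ex_derive_n (fun z => h t z) 2 v /\
    pde_lhs p (loglin_cw p h) h t v = 0.

Definition exp_poly (n : nat) (A : nat -> R -> R) (T t v : R) : R :=
  exp (A 0%nat (T - t)
       + sum_n_m (fun k => 1 / INR k * A k (T - t) * v ^ k) 1 n).

Definition initial_conditions (p : model) (n : nat) (A : nat -> R -> R) : Prop :=
  A 0%nat 0 = (phi p - 1) * ln (eps p) /\
  forall k, (1 <= k <= n)%nat -> A k 0 = 0.

Definition approx_coefficients (p : model) (T : R) (n : nat)
    (A : nat -> R -> R) : Prop :=
  initial_conditions p n A /\ approx_solution p T (exp_poly n A T).

Definition has_approx_solution (p : model) (T : R) (n : nat) : Prop :=
  exists A : nat -> R -> R, approx_coefficients p T n A.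

(* For n >= 1 the A_k are governed by equations of Riccati type, which for some
   parameters blow up in finite time.  This says that blow-up occurs at a time
   to maturity tau <= T: the same A_k give approximate solutions for every
   horizon shorter than tau, and |A_0| + ... + |A_n| tends to infinity at tau. *)
Definition explodes_by (p : model) (T : R) (n : nat) : Prop :=
  exists (tau : R) (A : nat -> R -> R),
    0 < tau <= T /\
    (forall T', 0 < T' < tau -> approx_coefficients p T' n A) /\
    filterlim (fun s => sum_n (fun k => Rabs (A k s)) n)
      (at_left tau) (Rbar_locally p_infty).

(* Main.v *)
Require Import Defs.
From Stdlib Require Import Reals Lra Lia FunctionalExtensionality ClassicalEpsilon Ranalysis5.
From Coquelicot Require Import Coquelicot.
Open Scope R_scope.

(** Put [h = exp (A0 + A1 v + A2 v^2 / 2)].  In the log-linear expansion the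
    constants [zeta3], [zeta4] combine with [ln h] so that the consumption-wealth
    ratio becomes
    [w * (1 - A1 (v - vbar) - A2 / 2 (v^2 - vbar^2))],
    where [w] is its exact value at [v = vbar].  This is a polynomial of degree at
    most two in [v], and under each set of hypotheses so is every other term of the
    equation ([pde_lhs_exp_quadratic]); cubic terms are absent because the variance
    [m2^2] is constant when [A2] is present.  Matching coefficients turns the
    equation into an autonomous system for [(A0, A1, A2)]
    ([riccati_solution_solves]) whose right-hand side is [w] times an affine
    function plus a quadratic polynomial, [w] being the exponential of minus an
    affine function.

    For [n = 0] the system is [A0' = beta^phi exp (- A0) + c], which is linear in
    [exp A0]; its explicit solution exists for all positive times
    ([constant_eta_solution]).

    For [n = 1, 2] the quadratic terms may cause blow-up, and what has to be shown is
    that a solution of the initial value problem either reaches time [T] or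
    explodes in norm by then.  The argument ([flow_or_blowup]) avoids gluing local
    solutions.  Multiply the vector field [f] by a positive function [psi] so
    small at infinity that [psi * f] is bounded and globally Lipschitz.  Its flow
    [U] exists for all times by Picard iteration ([lipschitz_flow]), and in the
    new clock [theta(s)], with [theta' = psi (U)], it is a solution of [u' = f(u)].
    If [theta] reaches [T] this solution covers [0, T].  Otherwise [theta]
    increases to some [tau <= T] as [s] tends to infinity; since [U] has bounded
    speed, each visit of [U] to a fixed ball takes at least a fixed amount of
    [theta], so from some moment on there are no more visits: the norm tends to
    infinity at [tau]. *)

(** * Global flows of bounded Lipschitz vector fields *)

Definition lipschitz {E V : NormedModule R_AbsRing} (f : E -> V) : Prop :=
  exists K, forall x y, norm (minus (f x) (f y)) <= K * norm (minus x y).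

Definition bounded_map {E V : NormedModule R_AbsRing} (f : E -> V) : Prop :=
  exists B, forall x, norm (f x) <= B.

Lemma lipschitz_pos {E V : NormedModule R_AbsRing} (f : E -> V) :
  lipschitz f ->
  exists K, 1 <= K /\ forall x y, norm (minus (f x) (f y)) <= K * norm (minus x y).
Proof.
  intros [K HK]. exists (Rmax 1 K). split; [apply Rmax_l|].
  intros x y. apply Rle_trans with (1 := HK x y).
  apply Rmult_le_compat_r; [apply norm_ge_0 | apply Rmax_r].
Qed.

Lemma lipschitz_continuous {E V : NormedModule R_AbsRing} (f : E -> V) (x : E) :
  lipschitz f -> continuous f x.
Proof.
  intros Hf. destruct (lipschitz_pos f Hf) as [K [HK1 HK]].
  apply filterlim_locally. intros eps.
  assert (Hd : 0 < eps / K) by (apply Rdiv_lt_0_compat; [apply cond_pos | lra]).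
  apply (locally_le_locally_norm x). exists (mkposreal _ Hd).
  intros y Hy. apply norm_compat1.
  apply Rle_lt_trans with (1 := HK y x).
  unfold ball_norm in Hy. simpl in Hy.
  apply Rlt_le_trans with (K * (eps / K)).
  - apply Rmult_lt_compat_l; [lra | exact Hy].
  - right. field. lra.
Qed.

Lemma norm_minus_triangle {V : NormedModule R_AbsRing} (x y z : V) :
  norm (minus x z) <= norm (minus x y) + norm (minus y z).
Proof. rewrite (minus_trans y x z). apply @norm_triangle. Qed.

Lemma norm_minus_sym {V : NormedModule R_AbsRing} (x y : V) :
  norm (minus x y) = norm (minus y x).
Proof. rewrite <- opp_minus. apply @norm_opp. Qed.

Lemma norm_minus_self {V : NormedModule R_AbsRing} (x : V) : norm (minus x x) = 0.
Proof. rewrite minus_eq_zero. apply @norm_zero. Qed.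

Lemma norm_le_plus_minus {V : NormedModule R_AbsRing} (x y : V) :
  norm y <= norm x + norm (minus y x).
Proof.
  assert (H1 := Rle_trans _ _ _ (Rle_abs _) (norm_triangle_inv y x)). lra.
Qed.

Lemma minus_plus_l {V : AbelianGroup} (x a b : V) :
  minus (plus x a) (plus x b) = minus a b.
Proof.
  change (plus (plus x a) (opp (plus x b)) = plus a (opp b)).
  rewrite opp_plus, (plus_comm x a), <- (plus_assoc a x), (plus_assoc x (opp x)),
    (plus_opp_r x).
  now rewrite plus_zero_l.
Qed.

Lemma minus_plus_cancel {V : AbelianGroup} (x a : V) : minus (plus x a) x = a.
Proof.
  change (plus (plus x a) (opp x) = a).
  rewrite (plus_comm x a), <- (plus_assoc a x), (plus_opp_r x). apply plus_zero_r.
Qed.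

(** The integral equation of [u' = G u], [u 0 = x0], as a fixed-point problem. *)
Definition picard {E : CompleteNormedModule R_AbsRing} (G : E -> E) (x0 : E)
    (u : R -> E) (t : R) : E :=
  plus x0 (RInt (fun s => G (u s)) 0 t).

Lemma picard_is_derive {E : CompleteNormedModule R_AbsRing} (G : E -> E) (x0 : E)
    (u : R -> E) (t : R) :
  lipschitz G -> (forall s, continuous u s) ->
  is_derive (picard G x0 u) t (G (u t)).
Proof.
  intros HG Hu.
  assert (Hc : forall s, continuous (fun s => G (u s)) s).
  { intros s. apply (continuous_comp u G); [apply Hu | now apply (@lipschitz_continuous E E)]. }
  unfold picard. rewrite <- (plus_zero_l (G (u t))).
  apply @is_derive_plus; [apply @is_derive_const|].
  apply (is_derive_RInt (fun s => G (u s)) _ 0).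
  - apply filter_forall. intros b. apply (@RInt_correct E).
    apply (@ex_RInt_continuous E). intros; apply Hc.
  - apply Hc.
Qed.

Lemma picard_continuous {E : CompleteNormedModule R_AbsRing} (G : E -> E) (x0 : E)
    (u : R -> E) (t : R) :
  lipschitz G -> (forall s, continuous u s) -> continuous (picard G x0 u) t.
Proof.
  intros HG Hu. apply @ex_derive_continuous. exists (G (u t)).
  now apply picard_is_derive.
Qed.

(** With the weight [exp (2 K t)], integrating a [K]-Lipschitz quantity gains a
    factor [K / (2 K)], on the whole half-line at once. *)
Lemma picard_contraction {E : CompleteNormedModule R_AbsRing} (G : E -> E) (x0 : E)
    (u v : R -> E) (K C : R) :
  1 <= K -> 0 <= C ->
  (forall x y, norm (minus (G x) (G y)) <= K * norm (minus x y)) ->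
  (forall s, continuous u s) -> (forall s, continuous v s) ->
  (forall s, 0 <= s -> norm (minus (u s) (v s)) <= C * exp (2 * K * s)) ->
  forall t, 0 <= t ->
  norm (minus (picard G x0 u t) (picard G x0 v t)) <= C / 2 * exp (2 * K * t).
Proof.
  intros HK HC HG Hu Hv Huv t Ht.
  assert (HGl : lipschitz G) by (now exists K).
  assert (Hex : forall w : R -> E, (forall s, continuous w s) ->
                ex_RInt (fun s => G (w s)) 0 t).
  { intros w Hw. apply (@ex_RInt_continuous E). intros s _.
    apply (continuous_comp w G); [apply Hw | now apply (@lipschitz_continuous E E)]. }
  unfold picard.
  replace (minus _ _) with
    (minus (RInt (fun s => G (u s)) 0 t) (RInt (fun s => G (v s)) 0 t)).
  2:{ symmetry. apply (@minus_plus_l E). }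
  rewrite <- (@RInt_minus E) by (now apply Hex).
  apply Rle_trans with (C / 2 * exp (2 * K * t) - C / 2 * exp (2 * K * 0)).
  2:{ assert (0 < exp (2 * K * 0)) by apply exp_pos. nra. }
  apply (norm_RInt_le (fun s => minus (G (u s)) (G (v s)))
           (fun s => C * K * exp (2 * K * s)) 0 t).
  - exact Ht.
  - intros s Hs. apply Rle_trans with (1 := HG _ _).
    assert (H := Huv s (proj1 Hs)).
    rewrite (Rmult_comm C K), Rmult_assoc. apply Rmult_le_compat_l; lra.
  - apply (@RInt_correct E). apply (@ex_RInt_minus E); now apply Hex.
  - apply (is_RInt_derive (fun s => C / 2 * exp (2 * K * s))).
    + intros s _. auto_derive; [exact I | field].
    + intros s _. apply @ex_derive_continuous. auto_derive. exact I.
Qed.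

Lemma norm_minus_lim {V : NormedModule R_AbsRing} (w : nat -> V) (l x : V) (c : R) (k : nat) :
  filterlim w eventually (locally l) ->
  (forall m, (k <= m)%nat -> norm (minus (w m) x) <= c) ->
  norm (minus l x) <= c.
Proof.
  intros Hl Hw. apply le_epsilon. intros eps He.
  destruct (proj1 (filterlim_locally_ball_norm w l) Hl (mkposreal eps He)) as [N HN].
  apply Rle_trans with (1 := norm_minus_triangle l (w (max N k)) x).
  rewrite Rplus_comm. apply Rplus_le_compat.
  - apply Hw. apply Nat.le_max_r.
  - rewrite norm_minus_sym. left. apply (HN (max N k)). apply Nat.le_max_l.
Qed.

Lemma half_pow_lt (c eps : R) : 0 < eps -> exists N, c * (/ 2) ^ N < eps.
Proof.
  intros He. assert (Hc : 0 < Rabs c + 1) by (assert (H := Rabs_pos c); lra).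
  destruct (pow_lt_1_zero (/ 2)) with (y := eps / (Rabs c + 1)) as [N HN].
  - rewrite Rabs_pos_eq; lra.
  - now apply Rdiv_lt_0_compat.
  - exists N. specialize (HN N (le_n N)).
    assert (Hp : 0 < (/ 2) ^ N) by (apply pow_lt; lra).
    rewrite Rabs_pos_eq in HN by lra.
    apply Rle_lt_trans with ((Rabs c + 1) * (/ 2) ^ N).
    + apply Rmult_le_compat_r; [lra|]. assert (H := Rle_abs c). lra.
    + apply Rlt_le_trans with ((Rabs c + 1) * (eps / (Rabs c + 1))).
      * now apply Rmult_lt_compat_l.
      * right. field. lra.
Qed.

(** The Picard iterates converge geometrically in the weighted norm of
    [picard_contraction]; boundedness of [G] makes the first step finite in
    that norm.  The solution is defined on the whole line, as the integral of a
    continuous function, so that its derivative at [0] is two-sided. *)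
Lemma lipschitz_flow {E : CompleteNormedModule R_AbsRing} (G : E -> E) (x0 : E) :
  lipschitz G -> bounded_map G ->
  exists U : R -> E, U 0 = x0 /\ (forall t, continuous U t) /\
    forall t, 0 <= t -> is_derive U t (G (U t)).
Proof.
  intros HG [B HB]. destruct (lipschitz_pos G HG) as [K [HK1 HK]].
  assert (HB0 : 0 <= B).
  { apply Rle_trans with (2 := HB x0). apply norm_ge_0. }
  set (u := fix u (k : nat) : R -> E :=
         match k with O => fun _ => x0 | S k => picard G x0 (u k) end).
  assert (Hc : forall k t, continuous (u k) t).
  { induction k as [|k IH]; intros t.
    - apply continuous_const.
    - now apply picard_continuous. }
  set (M := fun t => exp (2 * K * t)).
  assert (HM : forall t, 0 < M t) by (intros; apply exp_pos).
  assert (Hstep : forall k t, 0 <= t ->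
            norm (minus (u (S k) t) (u k t)) <= B * (/ 2) ^ k * M t).
  { induction k as [|k IH]; intros t Ht.
    - change (norm (minus (plus x0 (RInt (fun _ => G x0) 0 t)) x0) <= B * 1 * M t).
      rewrite (@RInt_const E).
      replace (minus (plus x0 (scal (t - 0) (G x0))) x0) with (scal (t - 0) (G x0)).
      2:{ symmetry. apply (@minus_plus_cancel E). }
      apply Rle_trans with (1 := norm_scal (t - 0) (G x0)).
      change (Rabs (t - 0) * norm (G x0) <= B * 1 * M t).
      rewrite Rabs_pos_eq by lra.
      assert (Ht2 : t <= M t).
      { assert (H := exp_ineq1_le (2 * K * t)). unfold M. nra. }
      assert (H1 := HB x0). assert (H2 := norm_ge_0 (G x0)). nra.
    - replace (B * (/ 2) ^ S k) with (B * (/ 2) ^ k / 2) by (simpl; field).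
      apply (picard_contraction G x0 (u (S k)) (u k) K); auto.
      apply Rmult_le_pos; [exact HB0 | apply pow_le; lra]. }
  assert (Hcauchy : forall k m t, (k <= m)%nat -> 0 <= t ->
            norm (minus (u m t) (u k t)) <= 2 * B * (/ 2) ^ k * M t).
  { intros k m t Hkm Ht.
    assert (Hs : norm (minus (u m t) (u k t))
                 <= 2 * B * ((/ 2) ^ k - (/ 2) ^ m) * M t).
    { induction Hkm as [|m Hkm IH].
      - apply Rle_trans with 0; [right; apply (@norm_minus_self E) | lra].
      - apply Rle_trans with (1 := norm_minus_triangle _ (u m t) _).
        apply Rle_trans with (1 := Rplus_le_compat _ _ _ _ (Hstep m t Ht) IH).
        simpl pow. lra. }
    apply Rle_trans with (1 := Hs).
    assert (0 < (/ 2) ^ m) by (apply pow_lt; lra). specialize (HM t).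
    assert (0 <= B * (/2) ^ m) by nra. nra. }
  assert (Hlim : forall t, exists l, filterlim (fun k => u k (Rmax 0 t)) eventually (locally l)).
  { intros t. apply (@filterlim_locally_cauchy nat E eventually _ (fun k => u k (Rmax 0 t))).
    intros eps.
    assert (Ht : 0 <= Rmax 0 t) by apply Rmax_l.
    destruct (half_pow_lt (4 * B * M (Rmax 0 t)) eps (cond_pos eps)) as [N HN].
    exists (fun k => (N <= k)%nat). split; [now exists N|].
    intros k m Hk Hm. apply (@norm_compat1 R_AbsRing E).
    apply Rle_lt_trans with (2 := HN).
    apply Rle_trans with (1 := norm_minus_triangle _ (u N (Rmax 0 t)) _).
    rewrite (norm_minus_sym (u N (Rmax 0 t))).
    apply Rle_trans with (1 := Rplus_le_compat _ _ _ _
      (Hcauchy N m _ Hm Ht) (Hcauchy N k _ Hk Ht)). lra. }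
  (* Convergence is only known on the half-line, while the integral equation is
     posed for functions continuous everywhere: hence the positive part of t. *)
  set (V := fun t => proj1_sig (constructive_indefinite_description _ (Hlim t))).
  assert (HV : forall t k, norm (minus (V t) (u k (Rmax 0 t)))
                           <= 2 * B * (/ 2) ^ k * M (Rmax 0 t)).
  { intros t k. unfold V. destruct (constructive_indefinite_description _ (Hlim t)) as [l Hl].
    simpl. apply (norm_minus_lim _ l _ _ k Hl). intros m Hm.
    apply Hcauchy; [exact Hm | apply Rmax_l]. }
  assert (HVc : forall t, continuous V t).
  { intros t. apply filterlim_locally. intros eps.
    set (b := M (Rmax 0 t + 1)).
    destruct (half_pow_lt (2 * B * b) (eps / 3)) as [N HN].
    { assert (H := cond_pos eps). lra. }
    assert (Hr : continuous (fun s => u N (Rmax 0 s)) t).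
    { apply (continuous_comp (fun s => Rmax 0 s) (u N)); [|apply Hc].
      apply (continuous_ext (fun s => (s + Rabs s) / 2)).
      - intros s. unfold Rmax, Rabs. destruct (Rle_dec 0 s), (Rcase_abs s); lra.
      - apply (continuous_mult (fun s : R => s + Rabs s) (fun _ => / 2));
          [|apply continuous_const].
        apply @continuous_plus; [apply continuous_id | apply continuous_Rabs]. }
    assert (He3 : 0 < eps / 3) by (assert (H := cond_pos eps); lra).
    assert (Hl := proj1 (filterlim_locally_ball_norm _ _) Hr (mkposreal _ He3)).
    assert (H1 : locally t (fun s => s < Rmax 0 t + 1)).
    { apply (open_lt (Rmax 0 t + 1)). assert (H := Rmax_r 0 t). lra. }
    generalize (filter_and _ _ Hl H1). apply filter_imp. intros s [Hs Hs1].
    apply (@norm_compat1 R_AbsRing E).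
    assert (HMb : forall x, 0 <= x <= Rmax 0 t + 1 -> 2 * B * (/ 2) ^ N * M x < eps / 3).
    { intros x Hx. apply Rle_lt_trans with (2 := HN).
      assert (M x <= b).
      { unfold M, b. destruct (Req_dec x (Rmax 0 t + 1)) as [->|Hn]; [right; reflexivity|].
        left. apply exp_increasing. nra. }
      assert (0 <= B * (/ 2) ^ N) by (apply Rmult_le_pos; [lra|apply pow_le; lra]).
      nra. }
    assert (Ht0 := Rmax_l 0 t).
    apply Rle_lt_trans with (1 := norm_minus_triangle _ (u N (Rmax 0 s)) _).
    replace (pos eps) with (eps / 3 + (eps / 3 + eps / 3)) by field.
    apply Rplus_lt_compat.
    + apply Rle_lt_trans with (1 := HV s N). apply HMb.
      split; [apply Rmax_l | apply Rmax_lub; lra].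
    + apply Rle_lt_trans with (1 := norm_minus_triangle _ (u N (Rmax 0 t)) _).
      apply Rplus_lt_compat; [exact Hs|].
      rewrite (norm_minus_sym (u N (Rmax 0 t)) (V t)).
      apply Rle_lt_trans with (1 := HV t N). apply HMb. lra. }
  assert (Hfix : forall t, 0 <= t -> picard G x0 V t = V t).
  { intros t Ht.
    assert (Hz : norm (minus (picard G x0 V t) (V t)) <= 0).
    { apply le_epsilon. intros eps He.
      destruct (half_pow_lt (2 * B * M t) eps He) as [N HN].
      apply Rle_trans with (1 := norm_minus_triangle _ (u (S N) t) _).
      assert (H1 : norm (minus (picard G x0 V t) (u (S N) t))
                   <= 2 * B * (/ 2) ^ N / 2 * M t).
      { apply (picard_contraction G x0 V (u N) K); auto.
        - apply Rmult_le_pos; [lra | apply pow_le; lra].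
        - intros s Hs. assert (H := HV s N). now rewrite Rmax_right in H. }
      assert (H2 := HV t (S N)). rewrite Rmax_right in H2 by exact Ht.
      rewrite (norm_minus_sym (u (S N) t) (V t)).
      apply Rle_trans with (1 := Rplus_le_compat _ _ _ _ H1 H2).
      simpl pow. lra. }
    assert (Hz0 : norm (minus (picard G x0 V t) (V t)) = 0).
    { apply Rle_antisym; [exact Hz | apply norm_ge_0]. }
    apply norm_eq_zero in Hz0.
    apply (plus_reg_r (opp (V t))). rewrite plus_opp_r. exact Hz0. }
  exists (picard G x0 V). split; [|split].
  - unfold picard. rewrite (@RInt_point E). apply plus_zero_r.
  - intros t. now apply picard_continuous.
  - intros t Ht. rewrite (Hfix t Ht). now apply picard_is_derive.
Qed.

(** * Existence up to a given time or explosion *)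

Lemma increasing_of_derive_pos (f df : R -> R) :
  (forall s, is_derive f s (df s)) -> (forall s, 0 < df s) ->
  forall s s', s < s' -> f s < f s'.
Proof.
  intros Hf Hpos s s' Hs.
  destruct (MVT_gen f s s' df) as [c [_ Hc]].
  - intros; apply Hf.
  - intros x _. apply derivable_continuous_pt. exists (df x).
    apply is_derive_Reals, Hf.
  - specialize (Hpos c). nra.
Qed.

(** The inverse is chosen on the range of [f]; by strict monotonicity and the
    intermediate value theorem that range contains a neighbourhood of each of
    its points, which gives continuity and then differentiability. *)
Lemma inverse_is_derive (f df : R -> R) :
  (forall s, is_derive f s (df s)) -> (forall s, 0 < df s) ->
  exists g : R -> R, (forall s, g (f s) = s) /\
    forall s, is_derive g (f s) (/ df s).
Proof.
  intros Hf Hpos.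
  assert (Hinc := increasing_of_derive_pos f df Hf Hpos).
  assert (Hder : forall a, derivable_pt f a).
  { intros a. exists (df a). apply is_derive_Reals, Hf. }
  (* Outside the range of f the value is arbitrary. *)
  set (g := fun t => epsilon (inhabits 0) (fun s => f s = t)).
  assert (Hfg : forall s, f (g (f s)) = f s).
  { intros s. apply (epsilon_spec (inhabits 0) (fun s' => f s' = f s)). now exists s. }
  assert (Hgf : forall s, g (f s) = s).
  { intros s. destruct (Rtotal_order (g (f s)) s) as [H|[H|H]]; auto;
      apply Hinc in H; rewrite Hfg in H; lra. }
  exists g. split; [exact Hgf|]. intros s.
  assert (Hlt : f (s - 1) < f s < f (s + 1)) by (split; apply Hinc; lra).
  assert (Himg : forall x, f (s - 1) <= x <= f (s + 1) ->
            exists y, s - 1 <= y <= s + 1 /\ f y = x).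
  { intros x Hx. destruct (IVT_gen f (s - 1) (s + 1) x) as [y [Hy1 Hy2]].
    - intros a. apply derivable_continuous_pt, Hder.
    - rewrite Rmin_left, Rmax_right by lra. exact Hx.
    - rewrite Rmin_left, Rmax_right in Hy1 by lra. now exists y. }
  assert (Hcont : continuity_pt g (f s)).
  { apply (continuity_pt_recip_interv f g (s - 1) (s + 1)); try lra.
    - intros x y _ Hxy _. now apply Hinc.
    - intros x H1 H2. destruct (Himg x (conj H1 H2)) as [y [_ <-]].
      unfold comp, id. now rewrite Hgf.
    - intros x H1 H2. destruct (Himg x (conj H1 H2)) as [y [Hy <-]].
      now rewrite Hgf.
    - intros a _. apply derivable_continuous_pt, Hder. }
  assert (Hin : g (f (s - 1)) <= g (f s) <= g (f (s + 1))) by (rewrite !Hgf; lra).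
  assert (Hd : derive_pt f (g (f s)) (Hder (g (f s))) = df s).
  { apply derive_pt_eq_0. rewrite Hgf. apply is_derive_Reals, Hf. }
  apply is_derive_Reals.
  replace (/ df s) with (1 / derive_pt f (g (f s)) (Hder (g (f s)))).
  2:{ rewrite Hd. unfold Rdiv. ring. }
  apply (derivable_pt_lim_recip_interv f g (f (s - 1)) (f (s + 1)) (f s)
           (fun a _ => Hder a) Hcont ltac:(lra) Hlt Hin).
  - intros x Hx. destruct (Himg x Hx) as [y [_ <-]]. unfold comp, id. now rewrite Hgf.
  - rewrite Hd. specialize (Hpos s). lra.
Qed.

(** In infinite dimension balls are not compact, so that positivity and continuity
    would not suffice for the lower bounds on the speed of the clock. *)
Definition ball_bounded_below {E : NormedModule R_AbsRing} (psi : E -> R) : Prop :=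
  forall M, exists c, 0 < c /\ forall x, norm x <= M -> c <= psi x.

(** The flow [U] of [psi * f] is a reparametrization of a solution of [u' = f u]:
    the time elapsed for [u] is [theta], the integral of [psi] along [U].
    The solution stops exactly when [theta] is bounded, and then [U] must leave
    every ball for good, as [theta] grows by a fixed amount during each unit of
    time that starts in the ball. *)
Lemma flow_or_blowup {E : CompleteNormedModule R_AbsRing} (f : E -> E) (psi : E -> R)
    (x0 : E) (T : R) :
  0 < T ->
  ball_bounded_below psi ->
  @lipschitz E R_NormedModule psi ->
  @lipschitz E E (fun x => scal (psi x) (f x)) ->
  @bounded_map E E (fun x => scal (psi x) (f x)) ->
  (exists u : R -> E, u 0 = x0 /\
     forall t, 0 <= t <= T -> is_derive u t (f (u t)))
  \/
  (exists (tau : R) (u : R -> E), 0 < tau <= T /\ u 0 = x0 /\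
     (forall t, 0 <= t < tau -> is_derive u t (f (u t))) /\
     filterlim (fun t => norm (u t)) (at_left tau) (Rbar_locally p_infty)).
Proof.
  intros HT Hlow Hpsi HGl HGb.
  assert (Hpos : forall x, 0 < psi x).
  { intros x. destruct (Hlow (norm x)) as [c [Hc0 Hc]].
    apply Rlt_le_trans with (1 := Hc0). apply Hc. lra. }
  set (G := fun x => scal (psi x) (f x)) in *.
  destruct (lipschitz_flow G x0 HGl HGb) as [U [HU0 [HUc HUd]]].
  assert (Hpc : forall s, continuous (fun s => psi (U s)) s).
  { intros s. apply (continuous_comp U psi); [apply HUc|].
    now apply (@lipschitz_continuous E R_NormedModule). }
  set (theta := RInt (fun s => psi (U s)) 0).
  assert (Hth : forall s, is_derive theta s (psi (U s))).
  { intros s. unfold theta. apply (is_derive_RInt (fun s => psi (U s)) _ 0).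
    - apply filter_forall. intros b. apply (@RInt_correct R_CompleteNormedModule).
      apply (@ex_RInt_continuous R_CompleteNormedModule). intros; apply Hpc.
    - apply Hpc. }
  assert (Hth0 : theta 0 = 0) by apply @RInt_point.
  assert (Hinc := increasing_of_derive_pos theta _ Hth (fun s => Hpos (U s))).
  destruct (inverse_is_derive theta _ Hth (fun s => Hpos (U s))) as [sigma [Hs Hsd]].
  assert (Hinv : forall t s, 0 <= t -> 0 <= s -> t <= theta s ->
            exists s', 0 <= s' /\ theta s' = t).
  { intros t s Ht Hs0 Hts. destruct (IVT_gen theta 0 s t) as [y [Hy1 Hy2]].
    - intros a. apply derivable_continuous_pt. exists (psi (U a)).
      apply is_derive_Reals, Hth.
    - rewrite Hth0, Rmin_left, Rmax_right by lra. lra.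
    - rewrite Rmin_left in Hy1 by lra. exists y. split; [apply Hy1 | exact Hy2]. }
  assert (Hu : forall s, 0 <= s ->
            is_derive (fun t => U (sigma t)) (theta s) (f (U (sigma (theta s))))).
  { intros s Hs0.
    replace (f (U (sigma (theta s)))) with (scal (/ psi (U s)) (G (U (sigma (theta s))))).
    2:{ rewrite Hs. unfold G. rewrite scal_assoc.
        replace (mult (/ psi (U s)) (psi (U s))) with (@one R_AbsRing).
        - apply (@scal_one R_AbsRing E).
        - symmetry. apply Rinv_l. specialize (Hpos (U s)). lra. }
    apply (is_derive_comp U sigma).
    - apply HUd. now rewrite Hs.
    - apply Hsd. }
  assert (Hu0 : U (sigma 0) = x0) by (rewrite <- Hth0, Hs; exact HU0).
  destruct (classic (exists s, 0 <= s /\ T <= theta s)) as [[S [HS HTS]]|Hno].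
  - left. exists (fun t => U (sigma t)). split; [exact Hu0|].
    intros t Ht. destruct (Hinv t S) as [s [Hs0 <-]]; try lra. now apply Hu.
  - right.
    destruct (completeness (fun t => exists s, 0 <= s /\ t = theta s)) as [tau [Hub Hlub]].
    { exists T. intros t [s [Hs0 ->]]. apply Rnot_lt_le. intros H.
      apply Hno. exists s. lra. }
    { exists 0, 0. split; [lra | now rewrite Hth0]. }
    assert (Hlt : forall s, 0 <= s -> theta s < tau).
    { intros s Hs0. apply Rlt_le_trans with (theta (s + 1)); [apply Hinc; lra|].
      apply Hub. exists (s + 1). split; [lra | reflexivity]. }
    assert (Hreach : forall t, 0 <= t < tau -> exists s, 0 <= s /\ theta s = t).
    { intros t Ht. apply NNPP. intros Hn.
      assert (tau <= t); [|lra]. apply Hlub. intros t' [s [Hs0 ->]].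
      apply Rnot_lt_le. intros H. apply Hn. apply (Hinv t s); lra. }
    assert (Htau : 0 < tau) by (rewrite <- Hth0; apply Hlt; lra).
    exists tau, (fun t => U (sigma t)). split; [split; [exact Htau|]|split; [exact Hu0|split]].
    + apply Hlub. intros t [s [Hs0 ->]]. apply Rnot_lt_le. intros H.
      apply Hno. exists s. lra.
    + intros t Ht. destruct (Hreach t Ht) as [s [Hs0 <-]]. now apply Hu.
    + destruct HGb as [B HB].
      assert (HB0 : 0 <= B) by (apply Rle_trans with (2 := HB x0); apply norm_ge_0).
      assert (Hspeed : forall s s', 0 <= s -> s <= s' <= s + 1 ->
                norm (minus (U s') (U s)) <= B).
      { intros s s' Hs0 Hs'. apply Rle_trans with ((s' - s) * B); [|nra].
        apply (norm_RInt_le_const (fun x => G (U x)) s s').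
        - lra.
        - intros; apply HB.
        - apply (@is_RInt_derive E).
          + intros x Hx. rewrite Rmin_left in Hx by lra. apply HUd. lra.
          + intros x _. apply (continuous_comp U G); [apply HUc|].
            now apply (@lipschitz_continuous E E). }
      (* From the ball of radius M, a unit of time at speed at most B leads no
         farther than M + B. *)
      intros P [M HM]. destruct (Hlow (M + B)) as [c [Hc0 Hc]].
      assert (Hd : 0 < Rmin c tau) by (apply Rmin_pos; lra).
      exists (mkposreal _ Hd). intros t Ht Htt. apply HM.
      unfold ball in Ht; simpl in Ht. unfold AbsRing_ball, abs, minus, plus, opp in Ht.
      simpl in Ht. apply Rabs_def2 in Ht.
      assert (H1 := Rmin_l c tau). assert (H2 := Rmin_r c tau).
      destruct (Hreach t) as [s [Hs0 <-]]; [lra|]. rewrite Hs.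
      apply Rnot_le_lt. intros Hle.
      assert (Hgrow : theta s + c <= theta (s + 1)).
      { destruct (MVT_gen theta s (s + 1) (fun x => psi (U x))) as [y [Hy Hy2]].
        - intros; apply Hth.
        - intros x _. apply derivable_continuous_pt. exists (psi (U x)).
          apply is_derive_Reals, Hth.
        - rewrite Rmin_left, Rmax_right in Hy by lra.
          assert (c <= psi (U y)); [|lra]. apply Hc.
          apply Rle_trans with (norm (U s) + norm (minus (U y) (U s))).
          + apply (@norm_le_plus_minus E).
          + apply Rplus_le_compat; [exact Hle | apply Hspeed; lra]. }
      assert (H3 := Hlt (s + 1)). lra.
Qed.

(** * Bounded Lipschitz scalar functions *)

(** [lipschitz] for real-valued functions, with absolute values instead of the
    norm of the normed module of reals, for the benefit of real arithmetic. *)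
Definition scalar_lipschitz {E : NormedModule R_AbsRing} (f : E -> R) : Prop :=
  exists K, forall x y, Rabs (f x - f y) <= K * norm (minus x y).

Definition tame {E : NormedModule R_AbsRing} (f : E -> R) : Prop :=
  scalar_lipschitz f /\ exists B, forall x, Rabs (f x) <= B.

Lemma scalar_lipschitz_plus {E : NormedModule R_AbsRing} (f g : E -> R) :
  scalar_lipschitz f -> scalar_lipschitz g -> scalar_lipschitz (fun x => f x + g x).
Proof.
  intros [K HK] [L HL]. exists (K + L). intros x y.
  replace (f x + g x - (f y + g y)) with ((f x - f y) + (g x - g y)) by ring.
  rewrite Rmult_plus_distr_r. apply Rle_trans with (1 := Rabs_triang _ _).
  now apply Rplus_le_compat.
Qed.

Lemma scalar_lipschitz_scale {E : NormedModule R_AbsRing} (k : R) (f : E -> R) :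
  scalar_lipschitz f -> scalar_lipschitz (fun x => k * f x).
Proof.
  intros [K HK]. exists (Rabs k * K). intros x y.
  rewrite <- Rmult_minus_distr_l, Rabs_mult, Rmult_assoc.
  apply Rmult_le_compat_l; [apply Rabs_pos | apply HK].
Qed.

Lemma scalar_lipschitz_const {E : NormedModule R_AbsRing} (k : R) :
  scalar_lipschitz (fun _ : E => k).
Proof. exists 0. intros x y. rewrite Rminus_diag, Rabs_R0. lra. Qed.

Lemma scalar_lipschitz_fst {E F : NormedModule R_AbsRing} (f : E -> R) :
  scalar_lipschitz f -> scalar_lipschitz (fun x : E * F => f (fst x)).
Proof.
  intros [K HK]. exists (Rabs K). intros x y. apply Rle_trans with (1 := HK _ _).
  apply Rle_trans with (Rabs K * norm (minus (fst x) (fst y))).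
  - apply Rmult_le_compat_r; [apply norm_ge_0 | apply Rle_abs].
  - apply Rmult_le_compat_l; [apply Rabs_pos|].
    apply (norm_le_prod_norm_1 (minus x y)).
Qed.

Lemma scalar_lipschitz_snd {E F : NormedModule R_AbsRing} (f : F -> R) :
  scalar_lipschitz f -> scalar_lipschitz (fun x : E * F => f (snd x)).
Proof.
  intros [K HK]. exists (Rabs K). intros x y. apply Rle_trans with (1 := HK _ _).
  apply Rle_trans with (Rabs K * norm (minus (snd x) (snd y))).
  - apply Rmult_le_compat_r; [apply norm_ge_0 | apply Rle_abs].
  - apply Rmult_le_compat_l; [apply Rabs_pos|].
    apply (norm_le_prod_norm_2 (minus x y)).
Qed.

Lemma scalar_lipschitz_id : @scalar_lipschitz R_NormedModule (fun x => x).
Proof. exists 1. intros x y. rewrite Rmult_1_l. apply Rle_refl. Qed.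

Lemma scalar_lipschitz_comp {E : NormedModule R_AbsRing} (g : R -> R) (f : E -> R) :
  @scalar_lipschitz R_NormedModule g -> scalar_lipschitz f ->
  scalar_lipschitz (fun x => g (f x)).
Proof.
  intros [K HK] [L HL]. exists (Rabs K * L). intros x y.
  apply Rle_trans with (1 := HK _ _).
  apply Rle_trans with (Rabs K * Rabs (f x - f y)).
  - apply Rmult_le_compat_r; [apply Rabs_pos | apply Rle_abs].
  - rewrite Rmult_assoc. apply Rmult_le_compat_l; [apply Rabs_pos | apply HL].
Qed.

Lemma tame_plus {E : NormedModule R_AbsRing} (f g : E -> R) :
  tame f -> tame g -> tame (fun x => f x + g x).
Proof.
  intros [Hf [B HB]] [Hg [C HC]]. split.
  - now apply scalar_lipschitz_plus.
  - exists (B + C). intros x. apply Rle_trans with (1 := Rabs_triang _ _).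
    now apply Rplus_le_compat.
Qed.

Lemma tame_scale {E : NormedModule R_AbsRing} (k : R) (f : E -> R) :
  tame f -> tame (fun x => k * f x).
Proof.
  intros [Hf [B HB]]. split.
  - now apply scalar_lipschitz_scale.
  - exists (Rabs k * B). intros x. rewrite Rabs_mult.
    apply Rmult_le_compat_l; [apply Rabs_pos | apply HB].
Qed.

(** Boundedness of both factors is what makes the product Lipschitz; this is why
    [tame] functions, and not Lipschitz functions, are the building blocks. *)
Lemma tame_mult {E : NormedModule R_AbsRing} (f g : E -> R) :
  tame f -> tame g -> tame (fun x => f x * g x).
Proof.
  intros [[K HK] [B HB]] [[L HL] [C HC]]. split.
  - exists (B * L + C * K). intros x y.
    replace (f x * g x - f y * g y) with (f x * (g x - g y) + g y * (f x - f y)) by ring.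
    rewrite Rmult_plus_distr_r, !Rmult_assoc.
    apply Rle_trans with (1 := Rabs_triang _ _). rewrite !Rabs_mult.
    apply Rplus_le_compat; apply Rmult_le_compat; auto using Rabs_pos.
  - exists (B * C). intros x. rewrite Rabs_mult.
    apply Rmult_le_compat; auto using Rabs_pos.
Qed.

Lemma tame_ext {E : NormedModule R_AbsRing} (f g : E -> R) :
  (forall x, f x = g x) -> tame f -> tame g.
Proof. intros H Hf. now rewrite <- (functional_extensionality f g H). Qed.

Lemma tame_comp {E : NormedModule R_AbsRing} (g : R -> R) (f : E -> R) :
  @tame R_NormedModule g -> scalar_lipschitz f -> tame (fun x => g (f x)).
Proof.
  intros [Hg [B HB]] Hf. split.
  - now apply scalar_lipschitz_comp.
  - exists B. intros x. apply HB.
Qed.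

Lemma tame_of_derive (g dg : R -> R) (B : R) :
  (forall x, is_derive g x (dg x)) -> (forall x, Rabs (dg x) <= 1) ->
  (forall x, Rabs (g x) <= B) -> @tame R_NormedModule g.
Proof.
  intros Hg Hd HB. split; [|now exists B].
  exists 1. intros x y. apply (bounded_variation g dg 1 y x). auto.
Qed.

Definition logistic (y : R) : R := / (1 + exp (- y)).
Definition damping (y : R) : R := / (1 + y ^ 2).

Lemma logistic_tame : @tame R_NormedModule logistic.
Proof.
  apply (tame_of_derive logistic (fun y => exp (- y) / (1 + exp (- y)) ^ 2) 1).
  - intros y. assert (H := exp_pos (- y)). unfold logistic.
    auto_derive; [lra | field; lra].
  - intros y. assert (H := exp_pos (- y)).
    rewrite Rabs_pos_eq.
    + apply Rle_div_l; nra.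
    + apply Rlt_le, Rdiv_lt_0_compat; nra.
  - intros y. assert (H := exp_pos (- y)). unfold logistic.
    rewrite Rabs_pos_eq by (apply Rlt_le, Rinv_0_lt_compat; lra).
    rewrite <- Rinv_1. apply Rinv_le_contravar; lra.
Qed.

Lemma Rabs_quotient_le (n d : R) : 0 < d -> - d <= n <= d -> Rabs (n / d) <= 1.
Proof.
  intros Hd Hn. apply Rabs_le. split.
  - apply Rle_div_r; lra.
  - apply Rle_div_l; lra.
Qed.

(** The bound on [k] is sharp, and degree two is all that occurs in the system for the
    coefficients. *)
Lemma damping_monomial_tame (k : nat) :
  (k <= 2)%nat -> @tame R_NormedModule (fun y => damping y * y ^ k).
Proof.
  assert (Hpos : forall y : R, 0 < 1 + y ^ 2) by (intros y; nra).
  assert (H0 : @tame R_NormedModule (fun y => damping y)).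
  { apply (tame_of_derive _ (fun y => (- (2 * y)) / (1 + y ^ 2) ^ 2) 1); intros y;
      specialize (Hpos y); unfold damping.
    - auto_derive; [lra | field; lra].
    - apply Rabs_quotient_le; [nra|]. assert (0 <= y ^ 2) by nra.
      assert (0 <= (1 - y)^2) by apply pow2_ge_0. assert (0 <= (1 + y)^2) by apply pow2_ge_0.
      split; nra.
    - rewrite <- Rdiv_1_l. apply Rabs_quotient_le; nra. }
  intros Hk. destruct k as [|[|[|k]]]; [| | |lia].
  - apply tame_ext with (2 := H0). intros y. simpl. ring.
  - apply (tame_of_derive _ (fun y => (1 - y ^ 2) / (1 + y ^ 2) ^ 2) 1); intros y;
      specialize (Hpos y); unfold damping.
    + auto_derive; [lra | field; lra].
    + apply Rabs_quotient_le; nra.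
    + rewrite Rmult_comm. simpl pow. rewrite Rmult_1_r.
      apply Rabs_quotient_le; nra.
  - apply tame_ext with (f := fun y : R_NormedModule => 1 + -1 * damping y).
    + intros y. unfold damping. specialize (Hpos y). field. lra.
    + apply (@tame_plus R_NormedModule).
      * split; [apply scalar_lipschitz_const | exists (Rabs 1); intros; lra].
      * now apply tame_scale.
Qed.

Lemma ball_bounded_below_mult {E : NormedModule R_AbsRing} (f g : E -> R) :
  ball_bounded_below f -> ball_bounded_below g -> ball_bounded_below (fun x => f x * g x).
Proof.
  intros Hf Hg M. destruct (Hf M) as [c [Hc0 Hc]]. destruct (Hg M) as [d [Hd0 Hd]].
  exists (c * d). split; [now apply Rmult_lt_0_compat|]. intros x Hx.
  apply Rmult_le_compat; auto; lra.
Qed.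

Lemma ball_bounded_below_comp {E : NormedModule R_AbsRing} (g : R -> R) (f : E -> R) :
  continuity g -> (forall y, 0 < g y) -> scalar_lipschitz f ->
  ball_bounded_below (fun x => g (f x)).
Proof.
  intros Hg Hpos [K HK] M. set (L := Rabs (f zero) + Rabs K * Rabs M).
  assert (HL : 0 <= L).
  { unfold L. assert (H1 := Rabs_pos (f zero)). assert (H2 := Rabs_pos K).
    assert (H3 := Rabs_pos M). nra. }
  destruct (continuity_ab_min g (- L) L) as [m [Hm _]]; [lra | intros; apply Hg|].
  exists (g m). split; [apply Hpos|]. intros x Hx. apply Hm.
  assert (H : Rabs (f x) <= L).
  { replace (f x) with (f zero + (f x - f zero)) by ring.
    apply Rle_trans with (1 := Rabs_triang _ _). apply Rplus_le_compat_l.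
    apply Rle_trans with (1 := HK x zero).
    apply Rle_trans with (Rabs K * norm (minus x zero)).
    - apply Rmult_le_compat_r; [apply norm_ge_0 | apply Rle_abs].
    - apply Rmult_le_compat_l; [apply Rabs_pos|].
      apply Rle_trans with (norm x).
      + right. f_equal. apply (@minus_zero_r E).
      + apply Rle_trans with (1 := Hx). apply Rle_abs. }
  apply Rabs_le_between. exact H.
Qed.

Lemma logistic_pos (y : R) : 0 < logistic y.
Proof. apply Rinv_0_lt_compat. assert (H := exp_pos (- y)). lra. Qed.

Lemma damping_pos (y : R) : 0 < damping y.
Proof. apply Rinv_0_lt_compat. nra. Qed.

Lemma logistic_continuity : continuity logistic.
Proof.
  intros y. apply derivable_continuous_pt. apply ex_derive_Reals_0. unfold logistic.
  auto_derive. assert (H := exp_pos (- y)). lra.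
Qed.

Lemma damping_continuity : continuity damping.
Proof.
  intros y. apply derivable_continuous_pt. apply ex_derive_Reals_0. unfold damping.
  auto_derive. nra.
Qed.

(** The factor [psi] of the time change.  The two dampings compensate quadratic
    growth in [a] and [b], the logistic factor the growth of [exp (- lam)]. *)
Definition clock {E : Type} (lam a b : E -> R) (x : E) : R :=
  logistic (lam x) * (damping (a x) * damping (b x)).

Lemma clock_ball_bounded_below {E : NormedModule R_AbsRing} (lam a b : E -> R) :
  scalar_lipschitz lam -> scalar_lipschitz a -> scalar_lipschitz b ->
  ball_bounded_below (clock lam a b).
Proof.
  intros Hl Ha Hb. unfold clock.
  repeat apply @ball_bounded_below_mult;
    apply ball_bounded_below_comp; auto using logistic_continuity, damping_continuity,
      logistic_pos, damping_pos.
Qed.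

Lemma clock_monomial_tame {E : NormedModule R_AbsRing} (lam a b : E -> R) (i j : nat) :
  scalar_lipschitz lam -> scalar_lipschitz a -> scalar_lipschitz b ->
  (i <= 2)%nat -> (j <= 2)%nat ->
  tame (fun x => clock lam a b x * (a x ^ i * b x ^ j)).
Proof.
  intros Hl Ha Hb Hi Hj.
  apply tame_ext with (f := fun x => logistic (lam x) *
    ((damping (a x) * a x ^ i) * (damping (b x) * b x ^ j))).
  { intros x. unfold clock. ring. }
  apply tame_mult; [apply tame_comp; [apply logistic_tame | exact Hl]|].
  apply tame_mult.
  - now apply (tame_comp _ a (damping_monomial_tame i Hi)).
  - now apply (tame_comp _ b (damping_monomial_tame j Hj)).
Qed.

(** Since [logistic l * exp (- l) = 1 - logistic l], the exponential is absorbed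
    without any bound on [lam]. *)
Lemma clock_exp_monomial_tame {E : NormedModule R_AbsRing} (lam a b : E -> R) (i j : nat) :
  scalar_lipschitz lam -> scalar_lipschitz a -> scalar_lipschitz b ->
  (i <= 2)%nat -> (j <= 2)%nat ->
  tame (fun x => clock lam a b x * (exp (- lam x) * (a x ^ i * b x ^ j))).
Proof.
  intros Hl Ha Hb Hi Hj.
  apply tame_ext with (f := fun x =>
    (damping (a x) * a x ^ i) * (damping (b x) * b x ^ j)
    + -1 * (clock lam a b x * (a x ^ i * b x ^ j))).
  { intros x. unfold clock, logistic. assert (H := exp_pos (- lam x)). field. lra. }
  apply tame_plus.
  - apply tame_mult.
    + now apply (tame_comp _ a (damping_monomial_tame i Hi)).
    + now apply (tame_comp _ b (damping_monomial_tame j Hj)).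
  - now apply tame_scale, clock_monomial_tame.
Qed.

(** The common shape of the right-hand sides of the system: an affine function
    times [exp (- l)], plus a quadratic polynomial. *)
Definition exp_riccati (k0 k1 k2 c0 c1 c2 c11 c12 c22 l a b : R) : R :=
  exp (- l) * (k0 + k1 * a + k2 * b)
  + (c0 + c1 * a + c2 * b + c11 * a ^ 2 + c12 * (a * b) + c22 * b ^ 2).

Lemma clock_exp_riccati_tame {E : NormedModule R_AbsRing} (lam a b : E -> R)
    (k0 k1 k2 c0 c1 c2 c11 c12 c22 : R) :
  scalar_lipschitz lam -> scalar_lipschitz a -> scalar_lipschitz b ->
  tame (fun x => clock lam a b x *
    exp_riccati k0 k1 k2 c0 c1 c2 c11 c12 c22 (lam x) (a x) (b x)).
Proof.
  intros Hl Ha Hb.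
  set (m := fun i j x => clock lam a b x * (a x ^ i * b x ^ j)).
  set (w := fun i j x => clock lam a b x * (exp (- lam x) * (a x ^ i * b x ^ j))).
  apply tame_ext with (f := fun x =>
    (k0 * w 0%nat 0%nat x + (k1 * w 1%nat 0%nat x + k2 * w 0%nat 1%nat x))
    + (c0 * m 0%nat 0%nat x + (c1 * m 1%nat 0%nat x + (c2 * m 0%nat 1%nat x
    + (c11 * m 2%nat 0%nat x + (c12 * m 1%nat 1%nat x + c22 * m 0%nat 2%nat x)))))).
  { intros x. unfold exp_riccati, m, w. ring. }
  repeat apply @tame_plus; apply @tame_scale;
    first [apply clock_monomial_tame | apply clock_exp_monomial_tame]; auto.
Qed.

Lemma tame_lipschitz {E : NormedModule R_AbsRing} (f : E -> R) :
  tame f -> @lipschitz E R_NormedModule f /\ @bounded_map E R_NormedModule f.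
Proof. intros [[K HK] [B HB]]. split; [now exists K | now exists B]. Qed.

(** * Products of normed modules *)

Definition prod_lim {U V : CompleteSpace} (F : (U * V -> Prop) -> Prop) : U * V :=
  (lim (filtermap fst F), lim (filtermap snd F)).

Lemma prod_lim_cauchy {U V : CompleteSpace} (F : (U * V -> Prop) -> Prop) :
  ProperFilter F -> @cauchy (prod_UniformSpace U V) F ->
  forall eps : posreal, F (@ball (prod_UniformSpace U V) (prod_lim F) eps).
Proof.
  intros HF HC eps.
  assert (H1 : F (fun x => ball (lim (filtermap fst F)) eps (fst x))).
  { apply (complete_cauchy (filtermap fst F)).
    - now apply filtermap_proper_filter.
    - intros d. destruct (HC d) as [[x y] Hxy]. exists x.
      unfold filtermap. revert Hxy. apply filter_imp. intros z Hz. apply Hz. }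
  assert (H2 : F (fun x => ball (lim (filtermap snd F)) eps (snd x))).
  { apply (complete_cauchy (filtermap snd F)).
    - now apply filtermap_proper_filter.
    - intros d. destruct (HC d) as [[x y] Hxy]. exists y.
      unfold filtermap. revert Hxy. apply filter_imp. intros z Hz. apply Hz. }
  exact (filter_and _ _ H1 H2).
Qed.

Lemma prod_lim_close {U V : CompleteSpace} (F G : (U * V -> Prop) -> Prop) :
  filter_le F G -> filter_le G F ->
  @close (prod_UniformSpace U V) (prod_lim F) (prod_lim G).
Proof.
  intros HFG HGF eps. split; apply close_lim; intros P HP;
    unfold filtermap in *; auto.
Qed.

(** The base is the canonical normed module structure on the product, so that its
    lemmas apply. *)
Definition prod_CompleteNormedModule (U V : CompleteNormedModule R_AbsRing) :
    CompleteNormedModule R_AbsRing :=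
  CompleteNormedModule.Pack R_AbsRing (U * V)
    (CompleteNormedModule.Class R_AbsRing (U * V)
       (NormedModule.class R_AbsRing (prod_NormedModule R_AbsRing U V))
       (CompleteSpace.Mixin (prod_UniformSpace U V) prod_lim prod_lim_cauchy prod_lim_close))
    (U * V).

Lemma is_derive_fst {V W : NormedModule R_AbsRing} (u : R -> V * W) (t : R) (l : V * W) :
  is_derive u t l -> is_derive (fun s => fst (u s)) t (fst l).
Proof.
  intros Hu. unfold is_derive in *.
  apply (filterdiff_comp u (fun x : V * W => fst x) (fun y => scal y l) (fun x => fst x)).
  - exact Hu.
  - apply filterdiff_linear. apply is_linear_fst.
Qed.

Lemma is_derive_snd {V W : NormedModule R_AbsRing} (u : R -> V * W) (t : R) (l : V * W) :
  is_derive u t l -> is_derive (fun s => snd (u s)) t (snd l).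
Proof.
  intros Hu. unfold is_derive in *.
  apply (filterdiff_comp u (fun x : V * W => snd x) (fun y => scal y l) (fun x => snd x)).
  - exact Hu.
  - apply filterdiff_linear. apply is_linear_snd.
Qed.

Lemma norm_pair_le {E F : NormedModule R_AbsRing} (x : E) (y : F) :
  norm (x, y) <= norm x + norm y.
Proof.
  assert (Hx := norm_ge_0 x). assert (Hy := norm_ge_0 y).
  change (sqrt (norm x ^ 2 + norm y ^ 2) <= norm x + norm y).
  rewrite <- (sqrt_pow2 (norm x + norm y)) by lra. apply sqrt_le_1_alt. nra.
Qed.

Lemma lipschitz_pair {E V W : NormedModule R_AbsRing} (f : E -> V) (g : E -> W) :
  lipschitz f /\ bounded_map f -> lipschitz g /\ bounded_map g ->
  lipschitz (fun x => (f x, g x)) /\ bounded_map (fun x => (f x, g x)).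
Proof.
  intros [[K HK] [B HB]] [[L HL] [C HC]]. split.
  - exists (K + L). intros x y. rewrite Rmult_plus_distr_r.
    apply Rle_trans with (1 := norm_pair_le (minus (f x) (f y)) (minus (g x) (g y))).
    now apply Rplus_le_compat.
  - exists (B + C). intros x. apply Rle_trans with (1 := norm_pair_le _ _).
    now apply Rplus_le_compat.
Qed.

(** * The equation on exponentials of quadratic polynomials *)

Definition exp_quadratic (A0 A1 A2 : R -> R) (T t v : R) : R :=
  exp (A0 (T - t) + A1 (T - t) * v + A2 (T - t) / 2 * v ^ 2).

(** The consumption-wealth ratio [beta^phi / h] at the long-run mean. *)
Definition cw_mean (p : model) (a0 a1 a2 : R) : R :=
  exp (- (a0 + a1 * vbar p + a2 * (vbar p ^ 2 / 2) - phi p * ln (beta p))).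

(** The coefficient of [h_v / h] in the equation, up to the factor
    [- 1 / (1 - phi)]. *)
Definition adjusted_drift (p : model) (v : R) : R :=
  m1 p v + rho p * (1 - gamma p) / gamma p * (eta p v * m2 p v).

(** After multiplication by [1 - phi], the terms in [h_v^2 / h^2] and [h_vv / h]
    contribute [(h_v / h)^2] with total weight [m2^2 * risk_factor]: the
    [2 - phi - gamma] of the equation drops to [1 - gamma]. *)
Definition risk_factor (p : model) : R :=
  (1 - gamma p + rho p ^ 2 * (1 - gamma p) ^ 2 / gamma p) / (2 * (1 - phi p)).

(** Everything becomes polynomial in [v]: the logarithmic derivatives of [h] are
    polynomials, and so is [ln h], through which the linearized
    consumption-wealth ratio depends on [v]. *)
Lemma pde_lhs_exp_quadratic (p : model) (A0 A1 A2 : R -> R) (b0 b1 b2 T t v : R) :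
  0 < beta p -> gamma p <> 0 -> phi p <> 1 ->
  is_derive A0 (T - t) b0 -> is_derive A1 (T - t) b1 -> is_derive A2 (T - t) b2 ->
  let a0 := A0 (T - t) in let a1 := A1 (T - t) in let a2 := A2 (T - t) in
  let h := exp_quadratic A0 A1 A2 T in
  ex_derive (fun s => h s v) t /\
  (1 - phi p) * pde_lhs p (loglin_cw p h) h t v =
  b0 + b1 * v + b2 / 2 * v ^ 2
  + (1 - phi p) * r p + beta p * phi p
  - cw_mean p a0 a1 a2
    * (1 - a1 * (v - vbar p) - a2 / 2 * (v ^ 2 - vbar p ^ 2))
  + (1 - phi p) / (2 * gamma p) * eta p v ^ 2
  - adjusted_drift p v * (a1 + a2 * v)
  + risk_factor p * m2 p v ^ 2 * (a1 + a2 * v) ^ 2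
  - m2 p v ^ 2 / 2 * a2.
Proof.
  intros Hbeta Hgamma Hphi H0 H1 H2 a0 a1 a2 h.
  assert (Ht : is_derive (fun s => h s v) t (- (b0 + b1 * v + b2 / 2 * v ^ 2) * h t v)).
  { unfold h, exp_quadratic. auto_derive.
    - repeat split; eexists; eassumption.
    - change (fun x => A0 x) with A0. change (fun x => A1 x) with A1.
      change (fun x => A2 x) with A2.
      replace (T + - t) with (T - t) by ring.
      rewrite (is_derive_unique _ _ _ H0), (is_derive_unique _ _ _ H1),
        (is_derive_unique _ _ _ H2).
      replace (A0 (T - t) + A1 (T - t) * v + A2 (T - t) * / 2 * (v * (v * 1)))
        with (A0 (T - t) + A1 (T - t) * v + A2 (T - t) / 2 * v ^ 2) by (simpl; field).
      field. }
  assert (Hv : forall y, is_derive (fun z => h t z) y ((a1 + a2 * y) * h t y)).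
  { intros y. unfold h, exp_quadratic, a1, a2. auto_derive; [exact I|].
    simpl. unfold Rminus, Rdiv. field. }
  assert (Hvv : Derive_n (fun z => h t z) 2 v = ((a1 + a2 * v) ^ 2 + a2) * h t v).
  { change (Derive (Derive (fun z => h t z)) v = ((a1 + a2 * v) ^ 2 + a2) * h t v).
    rewrite (Derive_ext _ (fun y => (a1 + a2 * y) * h t y))
      by (intros y; apply is_derive_unique, Hv).
    apply is_derive_unique.
    replace (((a1 + a2 * v) ^ 2 + a2) * h t v)
      with (a2 * h t v + (a1 + a2 * v) * ((a1 + a2 * v) * h t v)) by ring.
    apply (is_derive_mult (fun y => a1 + a2 * y) (fun y => h t y)).
    - auto_derive; [exact I | ring].
    - apply Hv.
    - intros; apply Rmult_comm. }
  split; [now exists (- (b0 + b1 * v + b2 / 2 * v ^ 2) * h t v)|].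
  assert (Hh : 0 < h t v) by apply exp_pos.
  assert (Hcw : loglin_cw p h t v = cw_mean p a0 a1 a2
                 * (1 - a1 * (v - vbar p) - a2 / 2 * (v ^ 2 - vbar p ^ 2))).
  { unfold loglin_cw, zeta3, zeta4, log_cw, cw_mean, h, exp_quadratic.
    rewrite !ln_exp. fold a0 a1 a2.
    replace (- (a0 + a1 * vbar p + a2 * (vbar p ^ 2 / 2) - phi p * ln (beta p)))
      with (phi p * ln (beta p) - (a0 + a1 * vbar p + a2 / 2 * vbar p ^ 2)) by field.
    ring. }
  assert (Dt : Derive (fun s => h s v) t = - (b0 + b1 * v + b2 / 2 * v ^ 2) * h t v)
    by exact (is_derive_unique _ _ _ Ht).
  assert (Dv : Derive (fun z => h t z) v = (a1 + a2 * v) * h t v)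
    by exact (is_derive_unique _ _ _ (Hv v)).
  unfold pde_lhs. rewrite Hcw, Hvv, Dt, Dv.
  unfold adjusted_drift, risk_factor. field.
  repeat split; lra.
Qed.

Lemma exp_quadratic_solves (p : model) (A0 A1 A2 B0 B1 B2 : R -> R) (T : R) :
  0 < beta p -> gamma p <> 0 -> phi p <> 1 ->
  (forall s, 0 <= s <= T ->
     is_derive A0 s (B0 s) /\ is_derive A1 s (B1 s) /\ is_derive A2 s (B2 s)) ->
  (forall s v, 0 <= s <= T -> state p v ->
     B0 s + B1 s * v + B2 s / 2 * v ^ 2
     + (1 - phi p) * r p + beta p * phi p
     - cw_mean p (A0 s) (A1 s) (A2 s)
       * (1 - A1 s * (v - vbar p) - A2 s / 2 * (v ^ 2 - vbar p ^ 2))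
     + (1 - phi p) / (2 * gamma p) * eta p v ^ 2
     - adjusted_drift p v * (A1 s + A2 s * v)
     + risk_factor p * m2 p v ^ 2 * (A1 s + A2 s * v) ^ 2
     - m2 p v ^ 2 / 2 * A2 s = 0) ->
  approx_solution p T (exp_quadratic A0 A1 A2 T).
Proof.
  intros Hbeta Hgamma Hphi HA Hres t v Ht Hv.
  assert (Hs : 0 <= T - t <= T) by lra.
  destruct (HA _ Hs) as [H0 [H1 H2]].
  destruct (pde_lhs_exp_quadratic p A0 A1 A2 _ _ _ T t v Hbeta Hgamma Hphi H0 H1 H2)
    as [Hd Heq].
  assert (Hdv : forall y, ex_derive (fun z => exp_quadratic A0 A1 A2 T t z) y).
  { intros y. unfold exp_quadratic. auto_derive. exact I. }
  split; [apply exp_pos|]. split; [exact Hd|]. split; [|split].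
  - apply filter_forall. exact Hdv.
  - change (ex_derive (Derive (fun z => exp_quadratic A0 A1 A2 T t z)) v).
    apply ex_derive_ext with (f := fun y =>
      (A1 (T - t) + A2 (T - t) * y) * exp_quadratic A0 A1 A2 T t y).
    + intros y. symmetry. apply is_derive_unique. unfold exp_quadratic.
      auto_derive; [exact I|]. simpl. unfold Rminus, Rdiv. field.
    + unfold exp_quadratic. auto_derive. exact I.
  - specialize (Hres _ v Hs Hv). rewrite <- Heq in Hres.
    apply Rmult_integral in Hres. destruct Hres as [H|H]; [lra | exact H].
Qed.

(** * The system for the coefficients *)

(** Coefficients of [eta^2], of the adjusted drift and of [m2^2] as polynomials
    in [v]. *)
Record coefs := Coefs {
  eta2_0 : R; eta2_1 : R; eta2_2 : R; drift_0 : R; drift_1 : R; var_0 : R; var_1 : R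
}.

Definition represents (p : model) (C : coefs) : Prop :=
  forall v, state p v ->
    eta p v ^ 2 = eta2_0 C + eta2_1 C * v + eta2_2 C * v ^ 2 /\
    adjusted_drift p v = drift_0 C + drift_1 C * v /\
    m2 p v ^ 2 = var_0 C + var_1 C * v.

(** [rhs0], [rhs1], [rhs2] come from the coefficients of [1], [v], [v^2] in
    [pde_lhs_exp_quadratic].  They omit the products of [var_1] and [a2], one of
    which vanishes in each of the cases of interest. *)
Definition rhs0 (p : model) (C : coefs) (a0 a1 a2 : R) : R :=
  cw_mean p a0 a1 a2 * (1 + a1 * vbar p + a2 / 2 * vbar p ^ 2)
  - (1 - phi p) * r p - beta p * phi p - (1 - phi p) / (2 * gamma p) * eta2_0 C
  + drift_0 C * a1 - risk_factor p * var_0 C * a1 ^ 2 + var_0 C / 2 * a2.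

Definition rhs1 (p : model) (C : coefs) (a0 a1 a2 : R) : R :=
  - cw_mean p a0 a1 a2 * a1 - (1 - phi p) / (2 * gamma p) * eta2_1 C
  + drift_1 C * a1 + drift_0 C * a2
  - risk_factor p * (var_1 C * a1 ^ 2 + 2 * var_0 C * (a1 * a2)).

Definition rhs2 (p : model) (C : coefs) (a0 a1 a2 : R) : R :=
  - cw_mean p a0 a1 a2 * a2 - (1 - phi p) / gamma p * eta2_2 C
  + 2 * drift_1 C * a2 - 2 * risk_factor p * var_0 C * a2 ^ 2.

Definition riccati_solution (p : model) (C : coefs) (A0 A1 A2 : R -> R) (s : R) : Prop :=
  is_derive A0 s (rhs0 p C (A0 s) (A1 s) (A2 s)) /\
  is_derive A1 s (rhs1 p C (A0 s) (A1 s) (A2 s)) /\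
  is_derive A2 s (rhs2 p C (A0 s) (A1 s) (A2 s)).

(** The condition on [var_1 C * A2 s] covers both uses: [A2 = 0] for a linear
    variance, and a constant variance.  It kills the cubic term, which no
    coefficient could balance. *)
Lemma riccati_solution_solves (p : model) (C : coefs) (A0 A1 A2 : R -> R) (T : R) :
  0 < beta p -> gamma p <> 0 -> phi p <> 1 -> represents p C ->
  (forall s, var_1 C * A2 s = 0) ->
  (forall s, 0 <= s <= T -> riccati_solution p C A0 A1 A2 s) ->
  approx_solution p T (exp_quadratic A0 A1 A2 T).
Proof.
  intros Hbeta Hgamma Hphi HC Hs1 HA.
  apply (exp_quadratic_solves p A0 A1 A2
    (fun s => rhs0 p C (A0 s) (A1 s) (A2 s)) (fun s => rhs1 p C (A0 s) (A1 s) (A2 s))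
    (fun s => rhs2 p C (A0 s) (A1 s) (A2 s))); auto.
  intros s v Hs Hv. destruct (HC v Hv) as [-> [-> ->]]. specialize (Hs1 s).
  unfold rhs0, rhs1, rhs2.
  (* What is left after matching coefficients: the terms omitted in the right-hand sides. *)
  transitivity (var_1 C * A2 s * (risk_factor p * (2 * A1 s * v ^ 2 + A2 s * v ^ 3) - v / 2)).
  - field. exact Hgamma.
  - rewrite Hs1. ring.
Qed.

Lemma rhs0_exp_riccati (p : model) (C : coefs) (a0 a1 a2 : R) :
  rhs0 p C a0 a1 a2 =
  exp_riccati 1 (vbar p) (vbar p ^ 2 / 2)
    (- (1 - phi p) * r p - beta p * phi p - (1 - phi p) / (2 * gamma p) * eta2_0 C)
    (drift_0 C) (var_0 C / 2) (- risk_factor p * var_0 C) 0 0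
    (a0 + a1 * vbar p + a2 * (vbar p ^ 2 / 2) - phi p * ln (beta p)) a1 a2.
Proof. unfold rhs0, exp_riccati, cw_mean, Rdiv. ring. Qed.

Lemma rhs1_exp_riccati (p : model) (C : coefs) (a0 a1 a2 : R) :
  rhs1 p C a0 a1 a2 =
  exp_riccati 0 (-1) 0 (- (1 - phi p) / (2 * gamma p) * eta2_1 C)
    (drift_1 C) (drift_0 C) (- risk_factor p * var_1 C) (- 2 * risk_factor p * var_0 C) 0
    (a0 + a1 * vbar p + a2 * (vbar p ^ 2 / 2) - phi p * ln (beta p)) a1 a2.
Proof. unfold rhs1, exp_riccati, cw_mean, Rdiv. ring. Qed.

Lemma rhs2_exp_riccati (p : model) (C : coefs) (a0 a1 a2 : R) :
  rhs2 p C a0 a1 a2 =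
  exp_riccati 0 0 (-1) (- (1 - phi p) / gamma p * eta2_2 C)
    0 (2 * drift_1 C) 0 0 (- 2 * risk_factor p * var_0 C)
    (a0 + a1 * vbar p + a2 * (vbar p ^ 2 / 2) - phi p * ln (beta p)) a1 a2.
Proof. unfold rhs2, exp_riccati, cw_mean, Rdiv. ring. Qed.

Lemma log_ratio_lipschitz {E : NormedModule R_AbsRing} (p : model) (a0 a1 a2 : E -> R) :
  scalar_lipschitz a0 -> scalar_lipschitz a1 -> scalar_lipschitz a2 ->
  scalar_lipschitz (fun x =>
    a0 x + a1 x * vbar p + a2 x * (vbar p ^ 2 / 2) - phi p * ln (beta p)).
Proof.
  intros H0 H1 H2.
  assert (H : scalar_lipschitz (fun x => a0 x +
    (vbar p * a1 x + (vbar p ^ 2 / 2 * a2 x + - (phi p * ln (beta p)))))).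
  { repeat apply @scalar_lipschitz_plus; try apply @scalar_lipschitz_scale;
      auto using @scalar_lipschitz_const. }
  destruct H as [K HK]. exists K. intros x y. apply Rle_trans with (2 := HK x y).
  right. f_equal. ring.
Qed.

Definition riccati_clock {E : Type} (p : model) (a0 a1 a2 : E -> R) : E -> R :=
  clock (fun x => a0 x + a1 x * vbar p + a2 x * (vbar p ^ 2 / 2) - phi p * ln (beta p)) a1 a2.

(** The hypotheses of [flow_or_blowup], component by component; [a0], [a1], [a2] are
    coordinate functions, the last one being zero for the planar system. *)
Lemma riccati_clock_tame {E : NormedModule R_AbsRing} (p : model) (C : coefs)
    (a0 a1 a2 : E -> R) :
  scalar_lipschitz a0 -> scalar_lipschitz a1 -> scalar_lipschitz a2 ->
  ball_bounded_below (riccati_clock p a0 a1 a2) /\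
  tame (riccati_clock p a0 a1 a2) /\
  tame (fun x => riccati_clock p a0 a1 a2 x * rhs0 p C (a0 x) (a1 x) (a2 x)) /\
  tame (fun x => riccati_clock p a0 a1 a2 x * rhs1 p C (a0 x) (a1 x) (a2 x)) /\
  tame (fun x => riccati_clock p a0 a1 a2 x * rhs2 p C (a0 x) (a1 x) (a2 x)).
Proof.
  intros H0 H1 H2. assert (Hl := log_ratio_lipschitz p a0 a1 a2 H0 H1 H2).
  assert (He := fun lam => clock_exp_riccati_tame lam a1 a2).
  unfold riccati_clock. split; [now apply clock_ball_bounded_below|]. split; [|split; [|split]].
  - apply tame_ext with (2 := He _ 0 0 0 1 0 0 0 0 0 Hl H1 H2).
    intros x. unfold exp_riccati. ring.
  - eapply tame_ext; [|eapply He; [exact Hl | exact H1 | exact H2]].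
    intros x. simpl. f_equal. symmetry. apply rhs0_exp_riccati.
  - eapply tame_ext; [|eapply He; [exact Hl | exact H1 | exact H2]].
    intros x. simpl. f_equal. symmetry. apply rhs1_exp_riccati.
  - eapply tame_ext; [|eapply He; [exact Hl | exact H1 | exact H2]].
    intros x. simpl. f_equal. symmetry. apply rhs2_exp_riccati.
Qed.

Lemma norm_R3_le (x : R * R * R) :
  @norm R_AbsRing (prod_NormedModule R_AbsRing
     (prod_NormedModule R_AbsRing R_NormedModule R_NormedModule) R_NormedModule) x
  <= Rabs (fst (fst x)) + Rabs (snd (fst x)) + Rabs (snd x).
Proof.
  destruct x as [[x y] z]. simpl fst. simpl snd.
  apply Rle_trans with (1 := @norm_pair_le _ R_NormedModule (x, y) z).
  apply Rplus_le_compat_r. apply (@norm_pair_le R_NormedModule R_NormedModule x y).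
Qed.

Lemma riccati3_alternative (p : model) (C : coefs) (a T : R) :
  0 < T ->
  (exists A0 A1 A2, A0 0 = a /\ A1 0 = 0 /\ A2 0 = 0 /\
     forall s, 0 <= s <= T -> riccati_solution p C A0 A1 A2 s)
  \/
  (exists tau A0 A1 A2, 0 < tau <= T /\ A0 0 = a /\ A1 0 = 0 /\ A2 0 = 0 /\
     (forall s, 0 <= s < tau -> riccati_solution p C A0 A1 A2 s) /\
     filterlim (fun s => Rabs (A0 s) + Rabs (A1 s) + Rabs (A2 s))
       (at_left tau) (Rbar_locally p_infty)).
Proof.
  intros HT.
  set (E := prod_CompleteNormedModule
     (prod_CompleteNormedModule R_CompleteNormedModule R_CompleteNormedModule)
     R_CompleteNormedModule).
  set (a0 := fun x : E => fst (fst x)). set (a1 := fun x : E => snd (fst x)).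
  set (a2 := fun x : E => snd x).
  set (F := fun x : E => ((rhs0 p C (a0 x) (a1 x) (a2 x), rhs1 p C (a0 x) (a1 x) (a2 x)),
                          rhs2 p C (a0 x) (a1 x) (a2 x)) : E).
  set (E2 := prod_NormedModule R_AbsRing R_NormedModule R_NormedModule).
  assert (L0 : @scalar_lipschitz E a0)
    by exact (@scalar_lipschitz_fst E2 R_NormedModule _
                (@scalar_lipschitz_fst R_NormedModule R_NormedModule _ scalar_lipschitz_id)).
  assert (L1 : @scalar_lipschitz E a1)
    by exact (@scalar_lipschitz_fst E2 R_NormedModule _
                (@scalar_lipschitz_snd R_NormedModule R_NormedModule _ scalar_lipschitz_id)).
  assert (L2 : @scalar_lipschitz E a2)
    by exact (@scalar_lipschitz_snd E2 R_NormedModule _ scalar_lipschitz_id).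
  destruct (riccati_clock_tame p C a0 a1 a2 L0 L1 L2) as [Hb [Hc [T0 [T1 T2]]]].
  destruct (lipschitz_pair _ _ (lipschitz_pair _ _ (tame_lipschitz _ T0) (tame_lipschitz _ T1))
              (tame_lipschitz _ T2)) as [HL HB].
  assert (Hsol : forall (u : R -> E) s, is_derive u s (F (u s)) ->
     riccati_solution p C (fun s => a0 (u s)) (fun s => a1 (u s)) (fun s => a2 (u s)) s).
  { intros u s Hu. split; [|split].
    - apply (is_derive_fst (fun s => fst (u s)) s (fst (F (u s)))).
      now apply (is_derive_fst u s (F (u s))).
    - apply (is_derive_snd (fun s => fst (u s)) s (fst (F (u s)))).
      now apply (is_derive_fst u s (F (u s))).
    - now apply (is_derive_snd u s (F (u s))). }
  destruct (@flow_or_blowup E F (riccati_clock p a0 a1 a2) ((a, 0), 0) T HT Hb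
              (proj1 (tame_lipschitz _ Hc)) HL HB)
    as [[u [Hu0 Hu]]|[tau [u [Htau [Hu0 [Hu Hlim]]]]]].
  - left. exists (fun s => a0 (u s)), (fun s => a1 (u s)), (fun s => a2 (u s)).
    unfold a0 at 1, a1 at 1, a2 at 1. rewrite Hu0.
    do 3 (split; [reflexivity|]). intros s Hs. now apply Hsol, Hu.
  - right. exists tau, (fun s => a0 (u s)), (fun s => a1 (u s)), (fun s => a2 (u s)).
    unfold a0 at 1, a1 at 1, a2 at 1. rewrite Hu0.
    split; [exact Htau|]. do 3 (split; [reflexivity|]). split.
    + intros s Hs. now apply Hsol, Hu.
    + apply filterlim_ge_p_infty with (2 := Hlim). apply filter_forall. intros s.
      apply (norm_R3_le (u s)).
Qed.

(** When [eta^2] is linear, [A2 = 0] is consistent with its own equation.  The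
    system is posed in the plane rather than in space so that this holds by
    construction, with no appeal to uniqueness. *)
Lemma riccati2_alternative (p : model) (C : coefs) (a T : R) :
  0 < T -> eta2_2 C = 0 ->
  (exists A0 A1, A0 0 = a /\ A1 0 = 0 /\
     forall s, 0 <= s <= T -> riccati_solution p C A0 A1 (fun _ => 0) s)
  \/
  (exists tau A0 A1, 0 < tau <= T /\ A0 0 = a /\ A1 0 = 0 /\
     (forall s, 0 <= s < tau -> riccati_solution p C A0 A1 (fun _ => 0) s) /\
     filterlim (fun s => Rabs (A0 s) + Rabs (A1 s)) (at_left tau) (Rbar_locally p_infty)).
Proof.
  intros HT He2.
  set (E := prod_CompleteNormedModule R_CompleteNormedModule R_CompleteNormedModule).
  set (a0 := fun x : E => fst x). set (a1 := fun x : E => snd x).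
  set (a2 := fun _ : E => 0).
  set (F := fun x : E => (rhs0 p C (a0 x) (a1 x) 0, rhs1 p C (a0 x) (a1 x) 0) : E).
  assert (L0 : @scalar_lipschitz E a0)
    by exact (@scalar_lipschitz_fst R_NormedModule R_NormedModule _ scalar_lipschitz_id).
  assert (L1 : @scalar_lipschitz E a1)
    by exact (@scalar_lipschitz_snd R_NormedModule R_NormedModule _ scalar_lipschitz_id).
  destruct (riccati_clock_tame p C a0 a1 a2 L0 L1 (scalar_lipschitz_const 0))
    as [Hb [Hc [T0 [T1 _]]]].
  destruct (lipschitz_pair _ _ (tame_lipschitz _ T0) (tame_lipschitz _ T1)) as [HL HB].
  assert (Hsol : forall (u : R -> E) s, is_derive u s (F (u s)) ->
     riccati_solution p C (fun s => a0 (u s)) (fun s => a1 (u s)) (fun _ => 0) s).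
  { intros u s Hu. split; [|split].
    - now apply (is_derive_fst u s (F (u s))).
    - now apply (is_derive_snd u s (F (u s))).
    - replace (rhs2 p C (a0 (u s)) (a1 (u s)) 0) with 0
        by (unfold rhs2; rewrite He2; ring).
      apply @is_derive_const. }
  destruct (@flow_or_blowup E F (riccati_clock p a0 a1 a2) (a, 0) T HT Hb
              (proj1 (tame_lipschitz _ Hc)) HL HB)
    as [[u [Hu0 Hu]]|[tau [u [Htau [Hu0 [Hu Hlim]]]]]].
  - left. exists (fun s => a0 (u s)), (fun s => a1 (u s)).
    unfold a0 at 1, a1 at 1. rewrite Hu0.
    do 2 (split; [reflexivity|]). intros s Hs. now apply Hsol, Hu.
  - right. exists tau, (fun s => a0 (u s)), (fun s => a1 (u s)).
    unfold a0 at 1, a1 at 1. rewrite Hu0.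
    split; [exact Htau|]. do 2 (split; [reflexivity|]). split.
    + intros s Hs. now apply Hsol, Hu.
    + apply filterlim_ge_p_infty with (2 := Hlim). apply filter_forall. intros s.
      rewrite (surjective_pairing (u s)).
      apply (@norm_pair_le R_NormedModule R_NormedModule).
Qed.

(** * Approximate solutions *)

Definition coef_family (A0 A1 A2 : R -> R) (k : nat) : R -> R :=
  match k with 0 => A0 | 1 => A1 | _ => A2 end%nat.

Lemma exp_poly_0 (A0 : R -> R) (T : R) :
  exp_poly 0 (coef_family A0 (fun _ => 0) (fun _ => 0)) T
  = exp_quadratic A0 (fun _ => 0) (fun _ => 0) T.
Proof.
  apply functional_extensionality; intros t. apply functional_extensionality; intros v.
  unfold exp_poly, exp_quadratic. rewrite sum_n_m_zero by lia.
  f_equal. change (A0 (T - t) + 0 = A0 (T - t) + 0 * v + 0 / 2 * v ^ 2). field.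
Qed.

Lemma exp_poly_1 (A0 A1 : R -> R) (T : R) :
  exp_poly 1 (coef_family A0 A1 (fun _ => 0)) T = exp_quadratic A0 A1 (fun _ => 0) T.
Proof.
  apply functional_extensionality; intros t. apply functional_extensionality; intros v.
  unfold exp_poly, exp_quadratic. rewrite sum_n_n. simpl. f_equal. field.
Qed.

Lemma exp_poly_2 (A0 A1 A2 : R -> R) (T : R) :
  exp_poly 2 (coef_family A0 A1 A2) T = exp_quadratic A0 A1 A2 T.
Proof.
  apply functional_extensionality; intros t. apply functional_extensionality; intros v.
  unfold exp_poly, exp_quadratic. rewrite sum_n_Sm by lia. rewrite sum_n_n.
  unfold plus. simpl. f_equal. field.
Qed.

Lemma initial_family (p : model) (n : nat) (A0 A1 A2 : R -> R) :
  A0 0 = (phi p - 1) * ln (eps p) -> A1 0 = 0 -> A2 0 = 0 ->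
  initial_conditions p n (coef_family A0 A1 A2).
Proof.
  intros H0 H1 H2. split; [exact H0|].
  intros [|[|k]] Hk; [lia | exact H1 | exact H2].
Qed.

(** [y = exp A0] satisfies the linear equation [y' = b + c y] with [b = beta^phi].
    Variation of constants gives
    [y = exp (c s) * (y0 + b * int_0^s exp (- c x) dx)], which is positive for
    [s >= 0] whatever the sign of [c]. *)
Lemma constant_eta_solution (p : model) (T : R) :
  0 < beta p -> gamma p <> 0 -> phi p <> 1 ->
  constant_on (state p) (eta p) -> has_approx_solution p T 0.
Proof.
  intros Hbeta Hgamma Hphi [k Hk].
  set (c := - ((1 - phi p) * r p + beta p * phi p
               + (1 - phi p) / (2 * gamma p) * k ^ 2)).
  set (b := exp (phi p * ln (beta p))).
  set (y0 := exp ((phi p - 1) * ln (eps p))).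
  set (I := RInt (fun s => exp (- c * s)) 0).
  set (A0 := fun s => c * s + ln (y0 + b * I s)).
  assert (Hb : 0 < b) by apply exp_pos.
  assert (Hy0 : 0 < y0) by apply exp_pos.
  assert (Hc : forall s, continuous (fun s => exp (- c * s)) s).
  { intros s. apply @ex_derive_continuous. auto_derive. exact Logic.I. }
  assert (Hex : forall s, ex_RInt (fun s => exp (- c * s)) 0 s).
  { intros s. apply (@ex_RInt_continuous R_CompleteNormedModule). intros; apply Hc. }
  assert (HI : forall s, is_derive I s (exp (- c * s))).
  { intros s. apply (is_derive_RInt (fun s => exp (- c * s)) I 0); [|apply Hc].
    apply filter_forall. intros x. apply (@RInt_correct R_CompleteNormedModule), Hex. }
  assert (HI0 : forall s, 0 <= s -> 0 <= I s).
  { intros s Hs. apply RInt_ge_0; [exact Hs | apply Hex|].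
    intros x _. apply Rlt_le, exp_pos. }
  exists (coef_family A0 (fun _ => 0) (fun _ => 0)). split.
  - split; [|intros j Hj; lia].
    simpl. unfold A0, I. rewrite RInt_point. unfold zero; simpl.
    rewrite !Rmult_0_r, Rplus_0_l, Rplus_0_r. apply ln_exp.
  - rewrite exp_poly_0.
    apply (exp_quadratic_solves p A0 _ _ (fun s => cw_mean p (A0 s) 0 0 + c)
             (fun _ => 0) (fun _ => 0) T Hbeta Hgamma Hphi).
    + intros s Hs. split; [|split; apply @is_derive_const].
      assert (Hy : 0 < y0 + b * I s).
      { assert (H := HI0 s (proj1 Hs)). nra. }
      assert (Hcw : cw_mean p (A0 s) 0 0 = b * exp (- c * s) / (y0 + b * I s)).
      { unfold cw_mean, A0, b.
        replace (- (c * s + ln (y0 + exp (phi p * ln (beta p)) * I s) + 0 * vbar p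
                    + 0 * (vbar p ^ 2 / 2) - phi p * ln (beta p)))
          with (phi p * ln (beta p) + (- c * s + - ln (y0 + b * I s)))
          by (unfold b; ring).
        rewrite !exp_plus, (exp_Ropp (ln _)), exp_ln by exact Hy.
        unfold b, Rdiv. ring. }
      rewrite Hcw. unfold A0. auto_derive.
      * split; [eexists; apply HI|]. split; [exact Hy | exact Logic.I].
      * change (fun x => I x) with I. rewrite (is_derive_unique _ _ _ (HI s)).
        field. lra.
    + intros s v _ Hv. rewrite (Hk v Hv). unfold c. field. exact Hgamma.
Qed.

Lemma linear_case (p : model) (C : coefs) (T : R) :
  0 < T -> 0 < beta p -> gamma p <> 0 -> phi p <> 1 ->
  represents p C -> eta2_2 C = 0 ->
  has_approx_solution p T 1 \/ explodes_by p T 1.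
Proof.
  intros HT Hbeta Hgamma Hphi HC He2.
  assert (Happrox : forall A0 A1 T', A0 0 = (phi p - 1) * ln (eps p) -> A1 0 = 0 ->
    (forall s, 0 <= s <= T' -> riccati_solution p C A0 A1 (fun _ => 0) s) ->
    approx_coefficients p T' 1 (coef_family A0 A1 (fun _ => 0))).
  { intros A0 A1 T' H0 H1 HA. split; [now apply initial_family|].
    rewrite exp_poly_1. apply (riccati_solution_solves p C); auto. intros; ring. }
  destruct (riccati2_alternative p C ((phi p - 1) * ln (eps p)) T HT He2)
    as [[A0 [A1 [H0 [H1 HA]]]]|[tau [A0 [A1 [Htau [H0 [H1 [HA Hlim]]]]]]]].
  - left. exists (coef_family A0 A1 (fun _ => 0)). now apply Happrox.
  - right. exists tau, (coef_family A0 A1 (fun _ => 0)). split; [exact Htau|]. split.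
    + intros T' HT'. apply Happrox; auto. intros s Hs. apply HA. lra.
    + apply filterlim_ext with (2 := Hlim). intros s.
      rewrite sum_Sn, sum_O. reflexivity.
Qed.

Lemma quadratic_case (p : model) (C : coefs) (T : R) :
  0 < T -> 0 < beta p -> gamma p <> 0 -> phi p <> 1 ->
  represents p C -> var_1 C = 0 ->
  has_approx_solution p T 2 \/ explodes_by p T 2.
Proof.
  intros HT Hbeta Hgamma Hphi HC Hs1.
  assert (Happrox : forall A0 A1 A2 T',
    A0 0 = (phi p - 1) * ln (eps p) -> A1 0 = 0 -> A2 0 = 0 ->
    (forall s, 0 <= s <= T' -> riccati_solution p C A0 A1 A2 s) ->
    approx_coefficients p T' 2 (coef_family A0 A1 A2)).
  { intros A0 A1 A2 T' H0 H1 H2 HA. split; [now apply initial_family|].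
    rewrite exp_poly_2. apply (riccati_solution_solves p C); auto.
    intros s. rewrite Hs1. ring. }
  destruct (riccati3_alternative p C ((phi p - 1) * ln (eps p)) T HT)
    as [[A0 [A1 [A2 [H0 [H1 [H2 HA]]]]]]
       |[tau [A0 [A1 [A2 [Htau [H0 [H1 [H2 [HA Hlim]]]]]]]]]].
  - left. exists (coef_family A0 A1 A2). now apply Happrox.
  - right. exists tau, (coef_family A0 A1 A2). split; [exact Htau|]. split.
    + intros T' HT'. apply Happrox; auto. intros s Hs. apply HA. lra.
    + apply filterlim_ext with (2 := Hlim). intros s.
      rewrite !sum_Sn, sum_O. reflexivity.
Qed.

Theorem theorem4p12 (p : model) (T : R)
  (hT : 0 < T) (hr : 0 < r p) (hbeta : 0 < beta p) (heps : 0 < eps p)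
  (hgamma : 0 < gamma p) (hgamma1 : gamma p <> 1)
  (hphi : 0 < phi p) (hphi1 : phi p <> 1)
  (hrho : -1 <= rho p <= 1) :
  (constant_on (state p) (eta p) ->
   has_approx_solution p T 0)
  /\
  (linear_on (state p) (fun v => eta p v ^ 2) ->
   linear_on (state p) (m1 p) ->
   linear_on (state p) (fun v => eta p v * m2 p v) ->
   linear_on (state p) (fun v => m2 p v ^ 2) ->
   has_approx_solution p T 1 \/ explodes_by p T 1)
  /\
  (quadratic_on (state p) (fun v => eta p v ^ 2) ->
   linear_on (state p) (m1 p) ->
   linear_on (state p) (fun v => eta p v * m2 p v) ->
   constant_on (state p) (fun v => m2 p v ^ 2) ->
   has_approx_solution p T 2 \/ explodes_by p T 2).
Proof.
  assert (hg : gamma p <> 0) by lra.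
  split; [|split].
  - now apply constant_eta_solution.
  - intros [x0 [x1 Hx]] [y0 [y1 Hy]] [z0 [z1 Hz]] [w0 [w1 Hw]].
    apply (linear_case p (Coefs x0 x1 0
             (y0 + rho p * (1 - gamma p) / gamma p * z0)
             (y1 + rho p * (1 - gamma p) / gamma p * z1) w0 w1)); auto.
    intros v Hv. unfold adjusted_drift.
    rewrite (Hx v Hv), (Hy v Hv), (Hz v Hv), (Hw v Hv). simpl. repeat split; ring.
  - intros [x0 [x1 [x2 Hx]]] [y0 [y1 Hy]] [z0 [z1 Hz]] [w0 Hw].
    apply (quadratic_case p (Coefs x0 x1 x2
             (y0 + rho p * (1 - gamma p) / gamma p * z0)
             (y1 + rho p * (1 - gamma p) / gamma p * z1) w0 0)); auto.
    intros v Hv. unfold adjusted_drift.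
    rewrite (Hx v Hv), (Hy v Hv), (Hz v Hv), (Hw v Hv). simpl. repeat split; ring.
Qed.
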